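(* Let $A$ be an srl-monoid. Then the set of strongly convex subalgebras of $A$, ordered by inclusion, is an algebraic distributive lattice in which $\mathsf{C}[a\wedge b] = \mathsf{C}[a] \vee \mathsf{C}[b]$ for all $a,b\in A^{-}$. Moreover, its compact elements are exactly the subalgebras of the form $\mathsf{C}[a]$ with $a\in A^{-}$.
   Context: A commutative l-monoid is an algebra $(A,\wedge,\vee,\cdot,e)$ of type $(2,2,2,0)$ such that $(A,\wedge,\vee)$ is a lattice, $(A,\cdot,e)$ is a commutative monoid and $(a\vee b)\cdot c=(a\cdot c)\vee(b\cdot c)$ for all $a,b,c\in A$. An algebra $(A,\wedge,\vee,\cdot,\rightarrow,e)$ of type $(2,2,2,2,0)$ is an srl-monoid if $(A,\wedge,\vee,\cdot,e)$ is a commutative l-monoid and there is a subalgebra $Q$ of $(A,\wedge,\vee,\cdot,e)$ such that for all $a,b\in A$ the set $\{q\in Q: a\cdot q\leq b\}$ has a maximum and $a\rightarrow b$ equals this maximum. $A^{-}=\{a\in A: a\le e\}$. A convex subalgebra is a subalgebra $H$ of $(A,\wedge,\vee,\cdot,\rightarrow,e)$ such that $a,b\in H$, $a\le c\le b$ imply $c\in H$; it is strongly convex if for all $a\in A$, $h\in H$ with $a\cdot h\le e\le h\rightarrow a$ one has $a\in H$. $\mathsf{C}[a]$ is the smallest strongly convex subalgebra containing $a$; $\vee$ on subalgebras is the join in the lattice of strongly convex subalgebras. *)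

(* Defs.v *)
From HB Require Import structures.
From mathcomp Require Import all_boot all_order.
From mathcomp Require Import boolp classical_sets.

Set Implicit Arguments.
Unset Strict Implicit.
Unset Printing Implicit Defensive.

Import Order.TTheory.
Local Open Scope classical_set_scope.
Local Open Scope group_scope.
Local Open Scope order_scope.

HB.mixin Record isCommLMonoid (d : Order.disp_t) A
    of Order.Lattice d A & Monoid A := {
  lmulC : commutative (@mul A);
  lmul_joinl : forall a b c : A, (a `|` b) * c = (a * c) `|` (b * c)
}.

#[short(type="commLMonoidType")]
HB.structure Definition CommLMonoid (d : Order.disp_t) :=
  {A of Order.Lattice d A & Monoid A & isCommLMonoid d A}.

Definition lmonoid_subalgebra (d : Order.disp_t) (A : commLMonoidType d)
    (Q : set A) : Prop :=
  [/\ Q 1,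
      forall a b, Q a -> Q b -> Q (a * b),
      forall a b, Q a -> Q b -> Q (a `&` b) &
      forall a b, Q a -> Q b -> Q (a `|` b)].

Definition is_maximum (d : Order.disp_t) (T : porderType d)
    (S : set T) (m : T) : Prop := S m /\ ubound S m.

(* The subalgebra Q is not part of the signature, only its existence is. *)
HB.mixin Record isSrlMonoid (d : Order.disp_t) A of CommLMonoid d A := {
  srimp : A -> A -> A;
  srimp_subproof : exists Q : set A, lmonoid_subalgebra Q /\
    forall a b : A, is_maximum [set q | Q q /\ a * q <= b] (srimp a b)
}.

#[short(type="srlMonoidType")]
HB.structure Definition SrlMonoid (d : Order.disp_t) :=
  {A of CommLMonoid d A & isSrlMonoid d A}.

Definition srl_subalgebra (d : Order.disp_t) (A : srlMonoidType d)
    (H : set A) : Prop :=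
  lmonoid_subalgebra H /\ forall a b, H a -> H b -> H (srimp a b).

Definition convex_subalgebra (d : Order.disp_t) (A : srlMonoidType d)
    (H : set A) : Prop :=
  srl_subalgebra H /\
  forall a b c, H a -> H b -> a <= c -> c <= b -> H c.

Definition strongly_convex (d : Order.disp_t) (A : srlMonoidType d)
    (H : set A) : Prop :=
  convex_subalgebra H /\
  forall a h, H h -> a * h <= 1 -> 1 <= srimp h a -> H a.

Record scSubalgebra (d : Order.disp_t) (A : srlMonoidType d) := ScSubalgebra {
  sc_set :> set A;
  sc_subproof : `[< strongly_convex sc_set >]
}.

HB.instance Definition _ d A := [isSub for @sc_set d A].
HB.instance Definition _ d A := [Choice of @scSubalgebra d A by <:].
HB.instance Definition _ d A :=
  [SubChoice_isSubPOrder of @scSubalgebra d A by <: with set_display].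

Lemma sc_leE (d : Order.disp_t) (A : srlMonoidType d)
    (H K : scSubalgebra A) : (H <= K) = `[< (H : set A) `<=` K >].
Proof. by []. Qed.

Lemma smallest_strongly_convex (d : Order.disp_t) (A : srlMonoidType d)
    (X : set A) : strongly_convex (smallest (@strongly_convex d A) X).
Proof.
split; [split; [split; [split|]|]|].
- by move=> M [[[[[]]]]].
- move=> a b Ha Hb M MX; have [[[[[_ h _ _] _] _] _] _] := MX.
  by apply: h; [exact: Ha|exact: Hb].
- move=> a b Ha Hb M MX; have [[[[[_ _ h _] _] _] _] _] := MX.
  by apply: h; [exact: Ha|exact: Hb].
- move=> a b Ha Hb M MX; have [[[[[_ _ _ h] _] _] _] _] := MX.
  by apply: h; [exact: Ha|exact: Hb].
- move=> a b Ha Hb M MX; have [[[[_ h] _] _] _] := MX.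
  by apply: h; [exact: Ha|exact: Hb].
- move=> a b c Ha Hb ac cb M MX; have [[[_ h] _] _] := MX.
  by apply: h ac cb; [exact: Ha|exact: Hb].
- move=> a h Hh ah ha M MX; have [[_ scM] _] := MX.
  by apply: scM ah ha; exact: Hh.
Qed.

Definition scgen (d : Order.disp_t) (A : srlMonoidType d) (a : A) :
    scSubalgebra A :=
  ScSubalgebra (asboolT (smallest_strongly_convex [set a])).

Definition is_join (d : Order.disp_t) (P : porderType d) (x y j : P) : Prop :=
  supremums [set x; y] j.

Definition is_meet (d : Order.disp_t) (P : porderType d) (x y m : P) : Prop :=
  infimums [set x; y] m.

(* The distributive law is x /\ (y \/ z) = (x /\ y) \/ (x /\ z). *)
Definition is_distributive_lattice (d : Order.disp_t) (P : porderType d) :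
    Prop :=
  [/\ forall x y : P, exists j, is_join x y j,
      forall x y : P, exists m, is_meet x y m &
      forall x y z yz x_yz xy xz : P,
        is_join y z yz -> is_meet x yz x_yz ->
        is_meet x y xy -> is_meet x z xz -> is_join xy xz x_yz].

Definition is_complete_lattice (d : Order.disp_t) (P : porderType d) : Prop :=
  forall S : set P,
    (exists s, supremums S s) /\ (exists i, infimums S i).

Definition compact_element (d : Order.disp_t) (P : porderType d) (c : P) :
    Prop :=
  forall (S : set P) (s : P), supremums S s -> c <= s ->
    exists F : seq P, [set` F] `<=` S /\
      exists2 f, supremums [set` F] f & c <= f.

Definition is_algebraic_lattice (d : Order.disp_t) (P : porderType d) : Prop :=
  is_complete_lattice P /\
  forall x : P, exists2 S : set P, S `<=` @compact_element d P & supremums S x.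

(* Main.v *)
(** Let [Q] be the subalgebra of the [q] with [1 -> q = q].  A strongly convex
  subalgebra [H] is determined by the filter [F] of those [q] in [H] that lie
  in [Q] and satisfy [q <= 1]: one has [x \in H] iff [q <= x] and [x * q <= 1]
  for some [q] in [F].  Conversely this formula defines a strongly convex
  subalgebra for every submonoid [F] of [Q] below [1].  So the join of a family
  consists of the [x] with [q <= x] and [x * q <= 1] for some finite product [q]
  of negative elements of [Q] taken from the members of the family: joins are
  finitary, which yields algebraicity and compactness of [C[a]].
  Distributivity rests on
  [(r `|` q) * (r `|` p) <= r `|` q * p] for [r], [q], [p] below [1]. *)

Require Import Defs.
From mathcomp Require Import all_boot all_order.
From mathcomp Require Import boolp classical_sets.

Set Implicit Arguments.
Unset Strict Implicit.
Unset Printing Implicit Defensive.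

Import Order.TTheory.

Section StronglyConvexSubalgebras.
Local Open Scope classical_set_scope.
Local Open Scope group_scope.
Local Open Scope order_scope.

(** * Order and product in a commutative l-monoid *)

Section CommLMonoidTheory.
Variables (d : Order.disp_t) (A : commLMonoidType d).
Implicit Types a b c r q p : A.

Lemma lmul_joinr a b c : a * (b `|` c) = (a * b) `|` (a * c).
Proof. by rewrite lmulC lmul_joinl !(lmulC _ a). Qed.

Lemma le_mul2r c a b : a <= b -> a * c <= b * c.
Proof. by move=> /join_idPl ab; rewrite -ab lmul_joinl leUr. Qed.

Lemma le_mul2l c a b : a <= b -> c * a <= c * b.
Proof. by rewrite !(lmulC c); exact: le_mul2r. Qed.

Lemma le_mul a b a' b' : a <= a' -> b <= b' -> a * b <= a' * b'.
Proof. by move=> aa bb; rewrite (le_trans (le_mul2r _ aa)) ?le_mul2l. Qed.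

Lemma mul_le1 a b : a <= 1 -> b <= 1 -> a * b <= 1.
Proof. by move=> a1 b1; rewrite -[leRHS]mulg1 le_mul. Qed.

Lemma mul_lel a b : b <= 1 -> a * b <= a.
Proof. by move=> b1; rewrite -[leRHS]mulg1 le_mul2l. Qed.

Lemma mul_ler a b : a <= 1 -> a * b <= b.
Proof. by rewrite lmulC; exact: mul_lel. Qed.

(** When the left side is expanded, every term except [q * p] has a factor [r] and another factor
    below [1], hence lies below [r]. *)
Lemma mul_joins_le r q p : r <= 1 -> q <= 1 -> p <= 1 ->
  (r `|` q) * (r `|` p) <= r `|` q * p.
Proof.
move=> r1 q1 p1; rewrite lmul_joinl !lmul_joinr !leUx.
by rewrite leUr !(lexUl _ (mul_lel _ _)) ?(lexUl _ (mul_ler _ _)).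
Qed.

End CommLMonoidTheory.

(** * The subalgebra [Q] and residuation *)

Section SrlMonoidTheory.
Variables (d : Order.disp_t) (A : srlMonoidType d).
Implicit Types (a b c h x y r q p : A) (F X : set A).
Implicit Types (H K L M : scSubalgebra A) (S : set (scSubalgebra A)).

Definition srl_base : set A := [set q | srimp 1 q = q].

(** [1 -> q] is the largest element of [Q] below [q], so it equals [q] exactly when [q] lies in [Q].
    Any witness of the existential axiom is therefore [srl_base]. *)
Lemma srl_base_spec : lmonoid_subalgebra srl_base /\
  forall a b, is_maximum [set q | srl_base q /\ a * q <= b] (srimp a b).
Proof.
have [Q [subQ maxQ]] := @srimp_subproof d A.
suff -> : srl_base = Q by [].
apply/seteqP; split => q.
  by move=> <-; have [[]] := maxQ 1 q.
move=> Qq; apply: le_anti; have [[_ qle] qmax] := maxQ 1 q.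
by rewrite mul1g in qle; rewrite qle qmax //= mul1g.
Qed.

Lemma srl_base1 : srl_base 1.
Proof. by have [[]] := srl_base_spec. Qed.

Lemma srl_baseM q p : srl_base q -> srl_base p -> srl_base (q * p).
Proof. by have [[_ h _ _] _] := srl_base_spec; exact: h. Qed.

Lemma srl_base_imp a b : srl_base (srimp a b).
Proof. by have [_ /(_ a b) [[]]] := srl_base_spec. Qed.

Lemma mul_srimp a b : a * srimp a b <= b.
Proof. by have [_ /(_ a b) [[]]] := srl_base_spec. Qed.

Lemma le_srimp a b q : srl_base q -> a * q <= b -> q <= srimp a b.
Proof. by move=> Qq aq; have [_ /(_ a b) [_]] := srl_base_spec; apply. Qed.

Lemma le1_srimp a b : a <= b -> 1 <= srimp a b.
Proof. by move=> ab; apply: le_srimp; [exact: srl_base1|rewrite mulg1]. Qed.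

Lemma srimp_le a b : 1 <= srimp a b -> a <= b.
Proof.
by move=> /(le_mul2l a); rewrite mulg1 => /le_trans; apply; exact: mul_srimp.
Qed.

Lemma srimp1_le a : srimp 1 a <= a.
Proof. by rewrite -[leLHS]mul1g mul_srimp. Qed.

(** * Closure properties of a strongly convex subalgebra *)

Section Membership.
Variable H : scSubalgebra A.

Lemma scP : strongly_convex H.
Proof. by apply/asboolP; exact: sc_subproof. Qed.

Lemma sc1 : sc_set H 1.
Proof. by have [[[[]]]] := scP. Qed.

Lemma scM x y : sc_set H x -> sc_set H y -> sc_set H (x * y).
Proof. by have [[[[_ h _ _] _] _] _] := scP; exact: h. Qed.

Lemma scI x y : sc_set H x -> sc_set H y -> sc_set H (x `&` y).
Proof. by have [[[[_ _ h _] _] _] _] := scP; exact: h. Qed.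

Lemma sc_imp x y : sc_set H x -> sc_set H y -> sc_set H (srimp x y).
Proof. by have [[[_ h] _] _] := scP; exact: h. Qed.

Lemma sc_between x y z :
  sc_set H x -> sc_set H y -> x <= z -> z <= y -> sc_set H z.
Proof. by have [[_ h] _] := scP; exact: h. Qed.

Lemma sc_negW x y : sc_set H x -> x <= y -> y <= 1 -> sc_set H y.
Proof. by move=> Hx; exact: sc_between Hx sc1. Qed.

(** Strong convexity with [1 <= y -> x] replaced by the equivalent [y <= x]. *)
Lemma sc_strong x y : sc_set H y -> y <= x -> x * y <= 1 -> sc_set H x.
Proof.
move=> Hy yx xy; have [_ h] := scP; apply: (h x y Hy xy); exact: le1_srimp.
Qed.

End Membership.

Lemma sc_leP H K : reflect ((H : set A) `<=` K) (H <= K).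
Proof. by rewrite sc_leE; exact: asboolP. Qed.

(** * Subalgebras described by negative elements of [Q] *)

Definition neg_part X : set A := [set q | [/\ X q, srl_base q & q <= 1]].

(* [x * (x -> 1) <= 1], so [1 -> (x `&` (x -> 1) `&` 1)] is a witness. *)
Lemma sc_negP H x : sc_set H x ->
  exists2 q, neg_part H q & q <= x /\ x * q <= 1.
Proof.
move=> Hx; set h := x `&` srimp x 1 `&` 1.
have qh : srimp 1 h <= h by exact: srimp1_le.
have [[hx hi] h1] : (h <= x /\ h <= srimp x 1) /\ h <= 1.
  by move: (lexx h); rewrite {2}/h !lexI => /andP[/andP[]].
exists (srimp 1 h); first split.
- apply: sc_imp (sc1 H) _; apply: scI (sc1 H); apply: scI => //.
  exact: sc_imp (sc1 H).
- exact: srl_base_imp.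
- exact: le_trans h1.
- split; first exact: le_trans hx.
  apply: le_trans (mul_srimp x 1); apply: le_mul2l; exact: le_trans hi.
Qed.

Definition sc_of_filter F : set A :=
  [set x | exists2 q, F q & q <= x /\ x * q <= 1].

Lemma strongly_convex_of_filter F : F 1 ->
    (forall q p, F q -> F p -> F (q * p)) ->
    F `<=` srl_base -> F `<=` [set q | q <= 1] ->
  strongly_convex (sc_of_filter F).
Proof.
move=> F1 FM FQ Fneg.
(* Two members share a witness: the product of their witnesses lies below both. *)
have common x y : sc_of_filter F x -> sc_of_filter F y ->
    exists2 q, F q & [/\ q <= x, x * q <= 1, q <= y & y * q <= 1].
  move=> [q Fq [qx xq]] [p Fp [py yp]]; exists (q * p); first exact: FM.
  have qpq : q * p <= q by apply: mul_lel; exact: Fneg.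
  have qpp : q * p <= p by apply: mul_ler; exact: Fneg.
  by split; [exact: le_trans qx|exact: le_trans (le_mul2l x qpq) xq|
             exact: le_trans py|exact: le_trans (le_mul2l y qpp) yp].
split; [split; [split; [split|]|]|].
- by exists 1 => //; rewrite mulg1.
- move=> x y [q Fq [qx xq]] [p Fp [py yp]]; exists (q * p); first exact: FM.
  split; first exact: le_mul.
  have -> : x * y * (q * p) = (x * q) * (y * p).
    by rewrite -!mulgA; congr (x * _); rewrite !mulgA (lmulC y).
  exact: mul_le1.
- move=> x y /common /[apply] -[q Fq [qx xq qy yq]]; exists q => //.
  by rewrite lexI qx qy; split=> //; exact: le_trans (le_mul2r q (leIl x y)) xq.
- move=> x y /common /[apply] -[q Fq [qx xq qy yq]]; exists q => //.
  by rewrite lmul_joinl leUx xq yq; split=> //; exact: lexUl.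
(* Each bound uses up one factor [q] on [x]: [x * q * q <= q <= y] puts [q * q], an element of [Q],
   below [x -> y], while [q * (x -> y) <= x * (x -> y) <= y] reduces the other bound to
   [y * q <= 1]. *)
- move=> x y /common /[apply] -[q Fq [qx xq qy yq]]; exists (q * q).
    exact: FM.
  split.
    apply: le_srimp; first by apply: srl_baseM; exact: FQ.
    by rewrite mulgA; apply: le_trans qy; exact: mul_ler.
  rewrite mulgA; apply: le_trans yq; apply: le_mul2r.
  by rewrite lmulC; apply: le_trans (mul_srimp x y); exact: le_mul2r.
- move=> x y z /common /[apply] -[q Fq [qx xq qy yq]] xz zy; exists q => //.
  by split; [exact: le_trans xz|apply: le_trans yq; exact: le_mul2r].
- move=> x h [q Fq [qh hq]] xh /srimp_le hx; exists q => //.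
  by split; [exact: le_trans hx|apply: le_trans xh; exact: le_mul2l].
Qed.

(** * Joins and meets of strongly convex subalgebras *)

Inductive prod_of X : A -> Prop :=
| prod_of1 : prod_of X 1
| prod_ofM q p : X q -> prod_of X p -> prod_of X (q * p).

Lemma prod_of_mul X q p : prod_of X q -> prod_of X p -> prod_of X (q * p).
Proof.
move=> Pq Pp; elim: Pq => [|x y Xx _ IH]; first by rewrite mul1g.
by rewrite -mulgA; exact: prod_ofM.
Qed.

Lemma prod_of_neg_part X q : prod_of (neg_part X) q -> srl_base q /\ q <= 1.
Proof.
elim=> [|x y [_ Qx x1] _ [Qy y1]]; first by split=> //; exact: srl_base1.
by split; [exact: srl_baseM|exact: mul_le1].
Qed.

Definition sc_span X : scSubalgebra A :=
  ScSubalgebra (asboolT (smallest_strongly_convex X)).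

Lemma sub_sc_span X : X `<=` sc_span X.
Proof. exact: sub_smallest. Qed.

Lemma sc_span_le X H : (sc_span X <= H) = `[< X `<=` H >].
Proof.
apply/sc_leP/asboolP => [XH x /(@sub_sc_span X) /XH //|XH].
exact: smallest_sub (scP H) XH.
Qed.

Definition sc_union S : set A :=
  \bigcup_(K in S) (K : set A).

Lemma sc_sup S : supremums S (sc_span (sc_union S)).
Proof.
split=> [K SK|K ubK].
  by apply/sc_leP => x Kx; apply: sub_sc_span; exists K.
rewrite sc_span_le; apply/asboolP => x [L SL Lx].
by have /sc_leP := ubK _ SL; apply.
Qed.

Lemma sc_supE S H : supremums S H -> H = sc_span (sc_union S).
Proof.
move=> [ubH leH]; have [ubs les] := sc_sup S.
by apply: le_anti; rewrite leH ?les.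
Qed.

(** The elements with such a witness form a strongly convex subalgebra containing every member of
    [S], so they include the join, which is the smallest one. *)
Lemma sc_supP S H x : supremums S H -> sc_set H x ->
  exists2 p, prod_of (neg_part (sc_union S)) p & p <= x /\ x * p <= 1.
Proof.
move=> /sc_supE -> /(_ (sc_of_filter (prod_of (neg_part (sc_union S))))).
apply; split.
  apply: strongly_convex_of_filter => [||q|q].
  - exact: prod_of1.
  - exact: prod_of_mul.
  - by case/prod_of_neg_part.
  - by case/prod_of_neg_part.
move=> y [K SK /sc_negP [q [Kq Qq q1] qy]]; exists q => //.
rewrite -[q]mulg1; apply: prod_ofM (prod_of1 _); split=> //; by exists K.
Qed.

Lemma sc_inf_subproof S :
  sc_span (\bigcap_(K in S) (K : set A)) = \bigcap_(K in S) (K : set A) :> set A.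
Proof.
apply/seteqP; split; last exact: sub_sc_span.
by move=> x /= Sx K SK; apply: Sx; split; [exact: scP|move=> y; apply].
Qed.

Lemma sc_inf S : infimums S (sc_span (\bigcap_(K in S) (K : set A))).
Proof.
split=> [K SK|K lbK]; apply/sc_leP; rewrite sc_inf_subproof.
  by move=> x; exact.
by move=> x Kx L SL; have /sc_leP := lbK _ SL; apply.
Qed.

Lemma sc_meetE H K L :
  is_meet H K L -> (L : set A) = ((H : set A) `&` (K : set A))%classic.
Proof.
move=> [lbL geL]; have [lbi gei] := sc_inf [set H; K].
have -> : L = sc_span (\bigcap_(M in [set H; K]) (M : set A)).
  by apply: le_anti; rewrite geL ?gei.
by rewrite sc_inf_subproof bigcap_setU !bigcap_set1.
Qed.

Lemma is_joinP H K L :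
  is_join H K L <-> [/\ H <= L, K <= L & forall M, H <= M -> K <= M -> L <= M].
Proof.
split=> [[ub le]|[HL KL le]].
  split; [by apply: ub; left|by apply: ub; right|move=> M HM KM].
  by apply: le => _ [->|->].
split=> [_ [->|->] //|M ubM]; by apply: le; apply: ubM; [left|right].
Qed.

(** Binary meets distribute over arbitrary joins; binary distributivity is the case of a pair. *)
Lemma sc_frame H S L M : supremums S L ->
    (forall K, S K -> ((H : set A) `&` (K : set A) `<=` M)%classic) ->
  ((H : set A) `&` (L : set A) `<=` M)%classic.
Proof.
move=> supL HSM x [Hx Lx].
have [r [Hr Qr r1] [rx xr]] := sc_negP Hx.
have [p Pp [px xp]] := sc_supP supL Lx.
(* Both [r] and [p] are witnesses for [x], hence so is their join; it remains to find that join in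
   [M]. *)
apply: (@sc_strong _ _ (r `|` p)); last 2 first.
- by rewrite leUx rx px.
- by rewrite lmul_joinr leUx xr xp.
(* Induction on the factors of [p]: [r \/ q] lies in both [H] and [K], hence in [M], and
   [(r \/ q) * (r \/ p') <= r \/ q * p' <= 1] allows convexity to conclude. *)
elim: Pp {px xp} => [|q p' [[K SK Kq] Qq q1] Pp' IH].
  by have /join_idPr -> := r1; exact: sc1.
have [_ p1] := prod_of_neg_part Pp'.
apply: sc_negW (mul_joins_le r1 q1 p1) _; last by rewrite leUx r1 mul_le1.
apply: scM IH; apply: (HSM _ SK).
have rq1 : r `|` q <= 1 by rewrite leUx r1.
by split; [exact: sc_negW Hr (leUl _ _) rq1|exact: sc_negW Kq (leUr _ _) rq1].
Qed.

(** * Principal subalgebras and compactness *)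

Lemma scgen_le a H : (scgen a <= H) = `[< sc_set H a >].
Proof.
rewrite [LHS](sc_span_le [set a]); congr asbool.
by apply/propext; split=> [|Ha _ ->]; [exact|].
Qed.

Lemma scgenW a H : sc_set H a -> scgen a <= H.
Proof. by move=> Ha; rewrite scgen_le; exact: asboolT. Qed.

Lemma scgen_id a : sc_set (scgen a) a.
Proof. by have := lexx (scgen a); rewrite scgen_le => /asboolP. Qed.

Lemma scgenI a b : a <= 1 -> b <= 1 ->
  is_join (scgen a) (scgen b) (scgen (a `&` b)).
Proof.
move=> a1 b1; apply/is_joinP; split.
- by apply: scgenW; apply: sc_negW a1; [exact: scgen_id|exact: leIl].
- by apply: scgenW; apply: sc_negW b1; [exact: scgen_id|exact: leIr].
- move=> M; rewrite !scgen_le => /asboolP Ma /asboolP Mb.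
  by apply: asboolT; exact: scI.
Qed.

(** One member of [S] is chosen for each of the finitely many factors of [p]. *)
Lemma prod_of_finite S p : prod_of (neg_part (sc_union S)) p ->
  exists2 s : seq (scSubalgebra A), [set` s] `<=` S &
    forall H, ubound [set` s] H -> sc_set H p.
Proof.
elim=> [|q p' [[K SK Kq] _ _] _ [s sS sp]].
  by exists [::] => // H _; exact: sc1.
exists (K :: s) => [L|H ubH].
  by rewrite /= in_cons => /orP[/eqP -> //|]; exact: sS.
apply: scM; last by apply: sp => L sL; apply: ubH; rewrite /= in_cons sL orbT.
have /sc_leP : K <= H by apply: ubH; rewrite /= in_cons eqxx.
exact.
Qed.

(** The witness [p] for [a] in the join already lies in the join of a finite subfamily, and strong
    convexity brings [a] along. *)
Lemma scgen_compact a : compact_element (scgen a).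
Proof.
move=> S L supL; rewrite scgen_le => /asboolP La.
have [p Pp [pa ap]] := sc_supP supL La.
have [s sS sp] := prod_of_finite Pp.
exists s; split=> //; have [ub le] := sc_sup [set` s].
exists (sc_span (sc_union [set` s])) => //.
apply: scgenW; apply: sc_strong pa ap; exact: sp.
Qed.

Lemma sc_sup_scgen H :
  supremums [set scgen a | a in [set a | sc_set H a /\ a <= 1]] H.
Proof.
split=> [_ [a [Ha _] <-]|K ubK]; first exact: scgenW.
apply/sc_leP => x /sc_negP [q [Hq _ q1] [qx xq]]; apply: sc_strong qx xq.
have : scgen q <= K by apply: ubK; exists q.
by rewrite scgen_le => /asboolP.
Qed.

(** A compact [H] is the join of finitely many [C[a]] with [a] negative in [H]; the meet of these
    generators generates [H]. *)
Lemma compact_scgenP H :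
  compact_element H <-> exists2 a, a <= 1 & H = scgen a.
Proof.
split=> [cH|[a _ ->]]; last exact: scgen_compact.
have [s [sS [K [_ leK] HK]]] := cH _ _ (sc_sup_scgen H) (lexx H).
(* The meet is built along the list, starting from [1] for the empty family. *)
have [a [Ha a1] ubs] : exists2 a, sc_set H a /\ a <= 1 &
    ubound [set` s] (scgen a).
  elim: s sS {leK} => [_|L s IH sS]; first by exists 1; [split=> //; exact: sc1|].
  have [|a [Ha a1] uba] := IH.
    by move=> M sM; apply: sS; rewrite /= in_cons sM orbT.
  have [|b [Hb b1] Lb] := sS L; first by rewrite /= in_cons eqxx.
  have [gea geb _] := (is_joinP _ _ _).1 (scgenI a1 b1).
  exists (a `&` b) => [|M].
    by split; [exact: scI|rewrite leIx2 // a1].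
  rewrite /= in_cons => /orP[/eqP ->|sM]; first by rewrite -Lb.
  by apply: le_trans gea; exact: uba.
exists a => //; apply: le_anti; rewrite scgenW // andbT.
by apply: le_trans HK _; exact: leK.
Qed.

(** * Completeness, algebraicity and distributivity *)

Lemma sc_complete : is_complete_lattice (scSubalgebra A).
Proof. by move=> S; split; eexists; [exact: sc_sup|exact: sc_inf]. Qed.

Lemma sc_algebraic : is_algebraic_lattice (scSubalgebra A).
Proof.
split=> [|H]; first exact: sc_complete.
eexists; last exact: sc_sup_scgen.
by move=> _ [a _ <-]; exact: scgen_compact.
Qed.

Lemma sc_distributive : is_distributive_lattice (scSubalgebra A).
Proof.
split=> [H K|H K|X Y Z YZ XYZ XY XZ jYZ /sc_meetE mXYZ /sc_meetE mXY /sc_meetE mXZ].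
- by eexists; exact: sc_sup.
- by eexists; exact: sc_inf.
have [/sc_leP YYZ /sc_leP ZYZ _] := (is_joinP _ _ _).1 jYZ.
apply/is_joinP; split.
- by apply/sc_leP; rewrite mXY mXYZ; exact: setIS.
- by apply/sc_leP; rewrite mXZ mXYZ; exact: setIS.
- move=> M /sc_leP XYM /sc_leP XZM; apply/sc_leP; rewrite mXYZ.
  by apply: sc_frame jYZ _ => _ [->|->]; rewrite -?mXY -?mXZ.
Qed.

End SrlMonoidTheory.
End StronglyConvexSubalgebras.

Theorem theorem4p7 (d : Order.disp_t) (A : srlMonoidType d) :
  [/\ is_algebraic_lattice (scSubalgebra A),
      is_distributive_lattice (scSubalgebra A),
      forall a b : A, (a <= 1%g)%O -> (b <= 1%g)%O ->
        is_join (scgen a) (scgen b) (scgen (a `&` b)%O) &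
      forall H : scSubalgebra A,
        compact_element H <-> exists2 a : A, (a <= 1%g)%O & H = scgen a].
Proof.
split.
- exact: sc_algebraic.
- exact: sc_distributive.
- exact: scgenI.
- exact: compact_scgenP.
Qed.
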